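(* Let $q\ge4$ be a prime power, $r\ge4$, and let $S\subseteq\mathrm{PG}(r,q)$ be a set of $q^{r-1}+2q^{r-2}$ points such that every hyperplane meets $S$ in $0$, $q^{r-2}+2q^{r-3}$ or $2q^{r-2}$ points. If $\tau$ is an $(r-i)$-dimensional subspace with $1\le i\le r-2$, then $$|\tau\cap S|\in\{2q^{r-i-1}+c(-q^{r-i-1}+2q^{r-i-2}): c\in\mathbb{Z},\ -q\le c\le1\}\cup\{0\}.$$ *)

(* Defs.v *)
From HB Require Import structures.
From mathcomp Require Import all_boot all_algebra.

Set Implicit Arguments.
Unset Strict Implicit.
Unset Printing Implicit Defensive.

Import GRing.Theory.

HB.instance Definition _ (F : finFieldType) (vT : vectType F) :
    isCountable {vspace vT} := CanIsCountable (@VectorInternalTheory.vs2mxK F vT).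
HB.instance Definition _ (F : finFieldType) (vT : vectType F) :
    isFinite {vspace vT} := CanIsFinite (@VectorInternalTheory.vs2mxK F vT).

(* PG(r, q) with q = #|F|: a k-dimensional projective subspace is a linear    *)
(* subspace of F^(r+1) of linear dimension k + 1.                             *)
Definition projsp (F : finFieldType) (r : nat) := {vspace 'rV[F]_r.+1}.

Definition has_pdim (F : finFieldType) (r : nat) (U : projsp F r) (k : nat) :=
  \dim U = k.+1.

Record point (F : finFieldType) (r : nat) := Point {
  point_space : {vspace 'rV[F]_r.+1};
  _ : \dim point_space == 1 }.

HB.instance Definition _ (F : finFieldType) (r : nat) :=
  [isSub for @point_space F r].
HB.instance Definition _ (F : finFieldType) (r : nat) :=
  [Finite of point F r by <:].

Definition points_on (F : finFieldType) (r : nat)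
    (U : projsp F r) : {set point F r} :=
  [set p | (point_space p <= U)%VS].

(* Main.v *)
(** Put a = q^(r-2) + 2 q^(r-3) and b = 2 q^(r-2).  A nonzero functional on F^(r+1)
    is of type 0, a or b according to the size of the section of S by its kernel.  The moment equations of orders 0, 1 and 2
    show that exactly q^3 - 1 nonzero functionals are of type 0 or b, and that
    type 0 occurs.  If z has type 0 and w has type b, the q hyperplanes other
    than z of the pencil spanned by z and w partition S, and since q is odd or
    divisible by 4 this forces them all to be of type 0 or b.  Hence, when tau
    meets S, joining the type-b functionals vanishing on tau to a fixed z of
    type 0 (which does not vanish on tau) bounds their number by q^2 - 1, that is
    at most q + 1 hyperplanes.  If h hyperplanes through tau have type b, the first
    moment over the hyperplanes through tau gives the formula with c = 1 - h. *)

Require Import Defs.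
From HB Require Import structures.
From mathcomp Require Import all_boot all_order all_algebra.
From mathcomp Require Import all_fingroup all_solvable all_field.
From mathcomp Require Import zify ring.
Set Implicit Arguments.
Unset Strict Implicit.
Unset Printing Implicit Defensive.
Import Order.TTheory GRing.Theory Num.Theory.

(** * Arithmetic of the counting equations *)

(** Here [Q] is q^(r-3), [s] is the size of S, and [x0], [x1], [x2] count the nonzero functionals of
    type 0, a, b. The terms 1, [s] and [s ^ 2] on the left are the contributions of the zero
    functional. *)
Lemma hyperplane_type_counts (q Q x0 x1 x2 : nat) : 4 <= q -> 0 < Q ->
  x0 + x1 + x2 + 1 = q ^ 4 * Q ->
  let a := Q * (q + 2) in let b := 2 * q * Q in let s := q * a in
  a * x1 + b * x2 + s = s * (q ^ 3 * Q) ->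
  a ^ 2 * x1 + b ^ 2 * x2 + s ^ 2 = s * (q ^ 3 * Q) + s * (s - 1) * (q ^ 2 * Q) ->
  x0 + x2 + 1 = q ^ 3 /\ 0 < x0.
Proof.
move=> q4 Q0 E0 a b s E1 E2.
have s0 : 0 < s by rewrite /s /a !muln_gt0 Q0; lia.
have {}E2 : a ^ 2 * x1 + b ^ 2 * x2 + s ^ 2 + s * (q ^ 2 * Q) =
   s * (q ^ 3 * Q) + s * s * (q ^ 2 * Q).
  rewrite E2 -addnA -mulnDl; congr (_ + _ * _).
  by case: (s) s0 => // m _; rewrite subn1 -mulnSr.
rewrite {}/s {}/a {}/b in E1 E2 {s0}.
have [k qk] : exists k, q = k + 2 by exists (q - 2); rewrite subnK // (leq_trans _ q4).
subst q; have k2 : 2 <= k by rewrite -(leq_add2r 2).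
have e1 : (k + 4) * x1 + 2 * (k + 2) * x2 + (k + 2) * (k + 4) =
    (k + 2) * (k + 4) * ((k + 2) ^ 3 * Q).
  apply/eqP; rewrite -(eqn_pmul2l Q0); apply/eqP.
  by move: E1; clear; lia.
(* Subtracting a times the first moment from the second eliminates [x1] and leaves the coefficient
   b(b - a) = 2 Q^2 q (q - 2) on [x2]. In terms of q the result is 2 x2 = (q^2 - 1)(q + 2). *)
have Eb : 2 * x2 = (k ^ 2 + 4 * k + 3) * (k + 4).
  have qq : 0 < Q ^ 2 * ((k + 2) * k) by rewrite !muln_gt0 Q0 addn2 (leq_trans _ k2).
  apply/eqP; rewrite -(eqn_pmul2l qq); apply/eqP.
  have := congr1 (muln (Q * (k + 4) * Q)) e1.
  by move: E2; clear; lia.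
have e0 : x1 + (k + 2) * (k ^ 2 + 4 * k + 3) + (k + 2) = (k + 2) * ((k + 2) ^ 3 * Q).
  have q20 : 0 < k + 4 by rewrite addn_gt0 orbT.
  apply/eqP; rewrite -(eqn_pmul2l q20); apply/eqP.
  have := congr1 (muln (k + 2)) Eb.
  by move: e1; clear; lia.
have Ex : x0 + x2 + 1 = (k + 2) ^ 3.
  by move: e0 E0; clear; lia.
(* Together [Ex] and [Eb] give 2 x0 = q (q - 1)^2, which is positive. *)
split=> //; move: Ex Eb k2; clear; case: x0 => // Ex Eb k2; exfalso.
nia.
Qed.

(** Since [y2] is positive, [y1 < q], so it suffices that q divides [y1]. For odd q this follows
    from q dividing (q + 2) y1, as q is prime to q + 2. *)
Lemma pencil_type_counts (q y1 y2 : nat) : odd q \/ 4 %| q -> 0 < y2 -> 0 < q ->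
  (q + 2) * y1 + 2 * q * y2 = q * (q + 2) -> y1 = 0.
Proof.
move=> oq y20 q0 E.
have lt1 : y1 < q by nia.
suff /dvdn_leq : q %| y1 by case: y1 lt1 {E} => // y1 lt1 /(_ isT); lia.
case: oq => [oq|/dvdnP[m qm]].
  have : q %| (q + 2) * y1 + 2 * q * y2 by rewrite E dvdn_mulr.
  rewrite dvdn_addl; last by rewrite mulnAC dvdn_mull.
  by rewrite Gauss_dvdr // /coprime gcdnDl -/(coprime _ _) coprimen2.
(* For q = 4m the equation is halved first: (q + 2)/2 = 2m + 1 is odd and prime to m, hence prime to
   q. *)
have E' : (2 * m + 1) * y1 + q * y2 = q * (2 * m + 1) by move: E; rewrite qm; lia.
have : q %| (2 * m + 1) * y1 + q * y2 by rewrite E' dvdn_mulr.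
rewrite dvdn_addl; last by rewrite dvdn_mulr.
rewrite Gauss_dvdr // qm (_ : 4 = 2 ^ 2) // coprimeMl coprimeXl ?andbT.
  by rewrite /coprime gcdnMDl gcdn1.
by rewrite coprime2n oddD oddM.
Qed.

(** Used with [P] = q^(i-1), [k] = r-i-2 and [n] the size of the section by tau; [h] is then the
    number of type-b hyperplanes through tau. Eliminating [X1] gives n (q - 1) = R (q + 2)(q - 1) +
    R (q - 2) X2, and R (q - 2) is prime to q - 1, so q - 1 divides [X2]. *)
Lemma subspace_section_size (q k P n X1 X2 : nat) : 4 <= q -> 0 < P ->
  let R := q ^ k in let a := P * R * (q + 2) in let b := 2 * q * (P * R) in
  let s := q * a in n <= s -> X1 + X2 + 1 = P * q ->
  a * X1 + b * X2 + s = n * (P * q) + (s - n) * P ->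
  exists2 h, X2 = (q - 1) * h & n = R * (q + 2) + R * (q - 2) * h.
Proof.
move=> q4 P0 R a b s ns EX E.
have [m qm] : exists m, q = m + 2 by exists (q - 2); rewrite subnK // (leq_trans _ q4).
have E1 : n * (m + 1) = R * (m + 4) * (m + 1) + R * m * X2.
  have {}E : a * X1 + b * X2 + s + n * P = n * (P * q) + s * P.
    by rewrite E -addnA -mulnDl subnK.
  apply/eqP; rewrite -(eqn_pmul2l P0); apply/eqP.
  have := congr1 (muln (P * R * (q + 2))) EX.
  move: E; rewrite /s /a /b; move: (R) => R'; rewrite qm; clear; lia.
have /dvdnP[h Xh] : m + 1 %| X2.
  have : m + 1 %| R * m * X2.
    by rewrite -(dvdn_addr _ (dvdn_mull (R * (m + 4)) (dvdnn _))) -E1 dvdn_mull.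
  rewrite Gauss_dvdr // coprimeMr [coprime _ m]coprime_sym /R qm.
  rewrite coprimeXr; last by rewrite [m + 2]addn2 -addn1 -[m.+1]addn1 coprimenS.
  by rewrite addn1 coprimenS.
exists h; first by rewrite Xh qm mulnC addn2 subn1 addn1.
have m1 : 0 < m + 1 by rewrite addn1.
apply/eqP; rewrite -(eqn_pmul2r m1) E1 Xh qm addnK; apply/eqP.
by move: (R); clear => R; lia.
Qed.

Lemma odd_or_dvd4_card_finField (F : finFieldType) : 4 <= #|F| -> odd #|F| \/ 4 %| #|F|.
Proof.
move=> F4; have /abelem_pgroup := finField_is_abelem F; rewrite /pgroup cardsT.
have /even_prime : prime (pdiv #|F|) by rewrite pdiv_prime // (leq_trans _ F4).
case=> [->|op] /p_natP[n Fn]; last by left; rewrite Fn oddX op orbT.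
right; rewrite Fn in F4 *; case: n F4 {Fn} => [|[|n]] // _.
by rewrite !expnS mulnA dvdn_mulr.
Qed.

Local Open Scope ring_scope.

(** * Linear functionals and annihilators *)

Definition functional_ker (F : finFieldType) (n : nat) (u : 'cV[F]_n) :
  {vspace 'rV[F]_n} := lker (linfun (mulmxr u : 'rV[F]_n -> 'rV[F]_1)).

Definition annihilator (F : finFieldType) (n : nat) (U : {vspace 'rV[F]_n}) :
  {set 'cV[F]_n} := [set u | (U <= functional_ker u)%VS].

Lemma mem_functional_ker (F : finFieldType) (n : nat) (u : 'cV[F]_n) (v : 'rV[F]_n) :
  (v \in functional_ker u) = (v *m u == 0).
Proof. by rewrite memv_ker lfunE. Qed.

(** With a basis of [U] as the rows of [A], the annihilator is the kernel of u -> A u. This map is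
    onto because [A] has a right inverse, so rank-nullity applies. *)
Lemma card_annihilator (F : finFieldType) (n : nat) (U : {vspace 'rV[F]_n}) :
  #|annihilator U| = (#|F| ^ (n - \dim U))%N.
Proof.
pose A := \matrix_(i < \dim U) (vbasis U)`_i.
have mulA (v : 'rV_(\dim U)) : v *m A = \sum_i v 0 i *: (vbasis U)`_i.
  by rewrite mulmx_sum_row; apply: eq_bigr => i _; rewrite rowK.
have /row_freeP[B AB] : row_free A.
  apply: inj_row_free => v /eqP; rewrite mulA => /eqP v0.
  have /freeP fr := basis_free (vbasisP U).
  by apply/rowP => i; rewrite mxE (fr _ v0).
pose f : 'Hom('cV[F]_n, 'cV[F]_(\dim U)) := linfun (mulmx A).
have dim_ker : \dim (lker f) = (n - \dim U)%N.
  have := limg_ker_dim f fullv; rewrite capfv dimvf dim_matrix mulr1.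
  have -> : limg f = fullv.
    apply/vspaceP => y; rewrite memvf; apply/memv_imgP.
    by exists (B *m y); rewrite ?memvf // lfunE /= mulmxA AB mul1mx.
  by rewrite dimvf dim_matrix mulr1 => /(canRL (addnK _)).
rewrite -dim_ker -card_vspace; apply: eq_card => u.
rewrite inE memv_ker lfunE /=.
apply/subvP/eqP => [sU|Au v /coord_vbasis ->].
  apply/row_matrixP => i; rewrite row_mul rowK row0.
  apply/eqP; rewrite -mem_functional_ker; apply: sU.
  by rewrite vbasis_mem // mem_nth // size_tuple.
rewrite mem_functional_ker.
have := mulA (\row_i coord (vbasis U) i v).
under eq_bigr do rewrite mxE.
by move=> <-; rewrite -mulmxA Au mulmx0.
Qed.

Lemma dim_functional_ker (F : finFieldType) (n : nat) (u : 'cV[F]_n) :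
  u != 0 -> \dim (functional_ker u) = n.-1.
Proof.
move=> u0.
have := limg_ker_dim (linfun (mulmxr u : 'rV[F]_n -> 'rV[F]_1)) fullv.
rewrite capfv -/(functional_ker u) dimvf dim_matrix mul1r => /(congr1 predn).
set d := \dim (limg _); suff -> : d = 1%N by rewrite addn1 => <-.
apply/eqP; rewrite eqn_leq; apply/andP; split.
  by rewrite (leq_trans (dimvS (subvf _))) // dimvf dim_matrix.
rewrite lt0n dimv_eq0; apply: contraNneq u0 => lim0.
apply/eqP/row_matrixP => i; rewrite row0 rowE.
apply/eqP; rewrite -mem_functional_ker memv_ker -memv0 -lim0 memv_img ?memvf //.
Qed.

Lemma functional_ker0 (F : finFieldType) (n : nat) :
  functional_ker (0 : 'cV[F]_n) = fullv.
Proof. by apply/vspaceP => v; rewrite memvf mem_functional_ker mulmx0 eqxx. Qed.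

(** * Points, section sizes and their moments *)

Lemma point_generator (F : finFieldType) (r : nat) (p : point F r) :
  exists2 v, v != 0 & point_space p = <[v]>%VS.
Proof.
case: p => U /= /eqP dU; have v0 : vpick U != 0 by rewrite vpick0 -dimv_eq0 dU.
exists (vpick U) => //; apply/eqP.
rewrite eq_sym eqEdim dim_vline v0 dU leqnn andbT.
by rewrite -memvE memv_pick.
Qed.

Lemma dim_add_point (F : finFieldType) (r : nat) (U : projsp F r) (p : point F r) :
  \dim (U + point_space p) = (\dim U + ~~ (point_space p <= U)%VS)%N.
Proof.
have /eqP dp := valP p.
have [/addv_idPl ->|npU] /= := boolP (_ <= U)%VS; first by rewrite addn0.
rewrite dimv_disjoint_sum; first by rewrite dp.
have [v v0 pv] := point_generator p; rewrite pv in npU *.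
apply/eqP; rewrite -subv0; apply/subvP => x; rewrite memv_cap => /andP[xU].
move/vlineP => [c xc]; rewrite xc in xU *.
have [->|c0] := eqVneq c 0; first by rewrite scale0r mem0v.
by move: xU; rewrite rpredZeq (negPf c0) /= memvE (negPf npU).
Qed.

(* u = 0 is allowed and gives #|S|; every hyperplane is the kernel of #|F| - 1
   functionals, so the counts below are #|F| - 1 times the projective ones. *)
Definition section_size (F : finFieldType) (r : nat) (S : {set point F r})
    (u : 'cV[F]_r.+1) : nat :=
  #|points_on (functional_ker u) :&: S|.

Lemma section_size0 (F : finFieldType) (r : nat) (S : {set point F r}) :
  section_size S 0 = #|S|.
Proof.
rewrite /section_size functional_ker0; apply: eq_card => p.
by rewrite !inE subvf.
Qed.

Lemma section_sizeE (F : finFieldType) (r : nat) (S : {set point F r}) u :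
  section_size S u = (\sum_(p in S) (point_space p <= functional_ker u)%VS)%N.
Proof.
rewrite /section_size -sum1_card big_mkcond [RHS]big_mkcond.
apply: eq_bigr => p _; rewrite !inE.
by case: (p \in S); rewrite ?andbF ?andbT //; case: ifP.
Qed.

Lemma section_sizeZ (F : finFieldType) (r : nat) (S : {set point F r}) u c :
  c != 0 -> section_size S (c *: u) = section_size S u.
Proof.
move=> c0; rewrite /section_size.
suff -> : functional_ker (c *: u) = functional_ker u by [].
apply/vspaceP => v; rewrite !mem_functional_ker -scalemxAr.
by rewrite scaler_eq0 (negPf c0).
Qed.

(** Double counting of incident pairs (u, p): for fixed p, the functionals vanishing on both [U] and
    p form the annihilator of their sum. *)
Lemma sum_section_size (F : finFieldType) (r : nat) (S : {set point F r})
    (U : projsp F r) :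
  (\sum_(u in annihilator U) section_size S u =
   \sum_(p in S) #|F| ^ (r.+1 - \dim (U + point_space p)))%N.
Proof.
under eq_bigr do rewrite section_sizeE.
rewrite exchange_big; apply: eq_bigr => p _.
rewrite -card_annihilator -sum1_card big_mkcond [RHS]big_mkcond.
apply: eq_bigr => u _; rewrite !inE subv_add.
by case: (U <= _)%VS; case: (_ <= _)%VS.
Qed.

(** The square counts ordered pairs of points of the section; once the first point p is fixed, this
    is the first moment over the annihilator of p. *)
Lemma sum_section_size_sqr (F : finFieldType) (r : nat) (S : {set point F r}) :
  (\sum_(u : 'cV[F]_r.+1) section_size S u ^ 2 =
   \sum_(p in S) \sum_(p' in S)
      #|F| ^ (r.+1 - \dim (point_space p + point_space p')))%N.
Proof.
transitivity (\sum_(u : 'cV[F]_r.+1) \sum_(p in S)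
    (point_space p <= functional_ker u)%VS * section_size S u)%N.
  by apply: eq_bigr => u _; rewrite -mulnn {1}section_sizeE big_distrl.
rewrite exchange_big; apply: eq_bigr => p _.
rewrite -(sum_section_size S (point_space p)) [RHS]big_mkcond.
apply: eq_bigr => u _; rewrite inE.
by case: (_ <= _)%VS; rewrite ?mul0n ?mul1n.
Qed.

(** The codimension of [U] is k + 1, since the ambient linear dimension is r + 1; joining a point
    outside [U] lowers it to k. *)
Lemma sum_section_size_annihilator (F : finFieldType) (r k : nat)
    (S : {set point F r}) (U : projsp F r) : (k + \dim U = r)%N ->
  (\sum_(u in annihilator U) section_size S u =
   (#|points_on U :&: S| * #|F| ^ k.+1 + (#|S| - #|points_on U :&: S|) * #|F| ^ k))%N.
Proof.
move=> dU; rewrite sum_section_size (bigID [pred p | p \in points_on U]) /=.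
congr (_ + _)%N.
  rewrite -sum_nat_const; apply: eq_big => [p|p]; first by rewrite in_setI andbC.
  case/andP=> _; rewrite inE => pU; rewrite dim_add_point pU.
  by congr (_ ^ _)%N; lia.
rewrite setIC -cardsD -sum_nat_const; apply: eq_big => [p|p].
  by rewrite !inE andbC.
case/andP=> _; rewrite inE => pU; rewrite dim_add_point pU.
by congr (_ ^ _)%N; lia.
Qed.

Lemma sum_section_size_all (F : finFieldType) (r : nat) (S : {set point F r}) :
  (\sum_(u : 'cV[F]_r.+1) section_size S u = #|S| * #|F| ^ r)%N.
Proof.
have := @sum_section_size_annihilator F r r S 0%VS; rewrite dimv0 addn0 => /(_ erefl).
have -> : #|points_on 0%VS :&: S| = 0%N.
  apply/eqP; rewrite cards_eq0; apply/eqP/setP => p; rewrite !inE.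
  by rewrite subv0 -dimv_eq0 (eqP (valP p)).
rewrite mul0n add0n subn0 => <-; apply: eq_bigl => u.
by rewrite inE sub0v.
Qed.

Lemma sum_section_size_sqr_all (F : finFieldType) (r : nat) (S : {set point F r}) :
  (0 < r)%N ->
  (\sum_(u : 'cV[F]_r.+1) section_size S u ^ 2 =
   #|S| * #|F| ^ r + #|S| * (#|S| - 1) * #|F| ^ (r - 1))%N.
Proof.
move=> r0; rewrite sum_section_size_sqr -mulnA -mulnDr -sum_nat_const.
apply: eq_bigr => p pS; rewrite (bigD1 p) //=; congr (_ + _)%N.
  by rewrite addvv (eqP (valP p)) subn1.
rewrite (cardsD1 p) pS addnC addnK -sum_nat_const; apply: eq_big => [x|x].
  by rewrite !inE andbC.
case/andP=> _ xp; rewrite dim_add_point (eqP (valP p)).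
suff -> : (point_space x <= point_space p)%VS = false by congr (_ ^ _)%N; lia.
apply: contraNF xp => xp; rewrite -val_eqE /= eqEdim xp.
by rewrite (eqP (valP p)) (eqP (valP x)).
Qed.

(* Since ker z misses S, each point of S lies on exactly one ker (w + c z). *)
Lemma sum_pencil_section_size (F : finFieldType) (r : nat) (S : {set point F r})
    (z w : 'cV[F]_r.+1) : section_size S z = 0%N ->
  (\sum_(c : F) section_size S (w + c *: z) = #|S|)%N.
Proof.
move=> /eqP; rewrite cards_eq0 => /eqP Sz.
under eq_bigr do rewrite section_sizeE.
rewrite exchange_big -sum1_card; apply: eq_bigr => p pS.
have [v v0 pv] := point_generator p.
have : p \notin points_on (functional_ker z) :&: S by rewrite Sz inE.
rewrite !inE pS andbT pv -memvE mem_functional_ker => vz.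
have scal1 (A : 'M[F]_1) : (A == 0) = (A 0 0 == 0).
  by apply/eqP/eqP => [->|A0]; [rewrite mxE|apply/matrixP => i j; rewrite !ord1 A0 mxE].
rewrite scal1 in vz.
(* The unique c for which w + c z vanishes at v; the denominator is nonzero as v is not in the
   kernel of z. *)
rewrite (bigD1 (- ((v *m w) 0 0 / (v *m z) 0 0))) //= big1 => [|c].
  rewrite -memvE mem_functional_ker scal1 mulmxDr -scalemxAr !mxE.
  by rewrite mulNr divfK ?subrr ?eqxx //; move: vz; rewrite mxE.
rewrite -memvE mem_functional_ker scal1 mulmxDr -scalemxAr => cn.
apply/eqP; rewrite eqb0; apply: contraNN cn => h; apply/eqP.
move: h vz; rewrite [X in X == 0]mxE [X in _ + X]mxE addr_eq0 => /eqP -> vz.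
by rewrite mulNr opprK mulfK.
Qed.


(** * Counting functionals by type *)

(** Leaving [h] arbitrary covers all the moments at once: constant 1, identity and square. *)
Lemma sum_three_valued (T : finType) (A : {set T}) (f : T -> nat)
    (h : nat -> nat) (a b : nat) :
    (0 < a)%N -> (a < b)%N ->
    {in A, forall x, [\/ f x = 0, f x = a | f x = b]%N} ->
  (\sum_(x in A) h (f x) = #|[set x in A | f x == 0%N]| * h 0%N +
    #|[set x in A | f x == a]| * h a + #|[set x in A | f x == b]| * h b)%N.
Proof.
move=> a0 ab fA.
have cnt (P : pred T) (e : nat) :
    (\sum_(x in A) P x * e = #|[set x in A | P x]| * e)%N.
  rewrite -big_distrl; congr (_ * _)%N; rewrite -sum1_card big_mkcond [RHS]big_mkcond.
  by apply: eq_bigr => x _; rewrite inE; case: (x \in A) => //; case: (P x).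
rewrite -!cnt -!big_split; apply: eq_bigr => x /fA /=.
have [a0' ba b0] : [/\ (a == 0)%N = false, (b == a)%N = false & (b == 0)%N = false].
  by split; lia.
case=> ->; rewrite ?eqxx ?a0' ?ba ?b0 ?[0%N == _]eq_sym ?[a == b]eq_sym ?a0' ?ba ?b0;
  by rewrite ?mul0n ?mul1n ?addn0 ?add0n.
Qed.

Definition three_sections (F : finFieldType) (r : nat) (S : {set point F r})
    (a b : nat) :=
  forall u, u != 0 ->
    [\/ section_size S u = 0, section_size S u = a | section_size S u = b]%N.

Lemma count_empty_and_large_sections (F : finFieldType) (r : nat)
    (S : {set point F r}) :
    let q := #|F| in let a := (q ^ (r - 3) * (q + 2))%N in
    let b := (2 * q * q ^ (r - 3))%N in
    (4 <= q)%N -> (3 <= r)%N -> #|S| = (q * a)%N -> three_sections S a b ->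
    let D k := [set u in [set~ 0] | section_size S u == k] in
  (#|D 0| + #|D b| + 1 = q ^ 3)%N /\ (0 < #|D 0|)%N.
Proof.
move=> q a b q4 r3 hS h3 D.
have Q0 : (0 < q ^ (r - 3))%N by rewrite expn_gt0; lia.
have a0 : (0 < a)%N by rewrite muln_gt0 Q0; lia.
have ab : (a < b)%N by rewrite /a /b; nia.
have qr k : (k <= 3)%N -> (q ^ (r - k) = q ^ (3 - k) * q ^ (r - 3))%N.
  by move=> k3; rewrite -expnD; congr (_ ^ _)%N; lia.
have hA : {in [set~ 0], forall u, [\/ section_size S u = 0, section_size S u = a
    | section_size S u = b]%N} by move=> u; rewrite !inE; apply: h3.
have sumA h : (\sum_(u : 'cV[F]_r.+1) h (section_size S u) =
    h #|S| + (#|D 0| * h 0 + #|D a| * h a + #|D b| * h b))%N.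
  rewrite -(sum_three_valued h a0 ab hA) (bigD1 0%R) //= section_size0; congr (_ + _)%N.
  by apply: eq_bigl => u; rewrite !inE.
apply: (@hyperplane_type_counts q (q ^ (r - 3)) #|D 0%N| #|D a| #|D b|) => //.
- have := sumA (fun=> 1%N); rewrite !muln1 sum_nat_const muln1 card_mx muln1 addnC => <-.
  by rewrite -expnD; congr (_ ^ _)%N; lia.
- have := sumA id; rewrite sum_section_size_all.
  rewrite muln0 add0n hS -/q -(qr 0%N) // subn0 -/a -/b => ->.
  by rewrite addnC ![(_ * #|_|)%N]mulnC.
- have := sumA (expn^~ 2%N); rewrite sum_section_size_sqr_all; last by lia.
  rewrite muln0 add0n hS -/q -(qr 0%N) // -(qr 1%N) // subn0 -/a -/b => ->.
  by rewrite addnC ![(_ * #|_|)%N]mulnC.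
Qed.

Lemma pencil_avoids_middle (F : finFieldType) (r Q : nat) (S : {set point F r})
    (z w : 'cV[F]_r.+1) (c : F) :
    let q := #|F| in let a := (Q * (q + 2))%N in let b := (2 * q * Q)%N in
    (4 <= q)%N -> (0 < Q)%N -> #|S| = (q * a)%N -> three_sections S a b ->
    section_size S z = 0%N -> w != 0 -> section_size S w = b ->
  w + c *: z != 0 /\ section_size S (w + c *: z) != a.
Proof.
move=> q a b q4 Q0 hS h3 z0 w0 wb.
have a0 : (0 < a)%N by rewrite muln_gt0 Q0; lia.
have ab : (a < b)%N by rewrite /a /b; nia.
(* Otherwise w would be a multiple of z, hence zero or of type 0, whereas it is nonzero of type b >
   0. *)
have nz d : w + d *: z != 0.
  rewrite addr_eq0 -scaleNr; apply: contraTneq (ltn_trans a0 ab) => wz.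
  rewrite -wb wz; have [d0|dn0] := eqVneq (- d) 0; last by rewrite section_sizeZ ?z0.
  by move: w0; rewrite wz d0 scale0r eqxx.
split=> //; have := sum_pencil_section_size w z0.
have hA : {in [set: F], forall d, [\/ section_size S (w + d *: z) = 0,
   section_size S (w + d *: z) = a | section_size S (w + d *: z) = b]%N}.
  by move=> d _; apply: h3.
have := sum_three_valued id a0 ab hA; set y0 := #|_|; set y1 := #|_|; set y2 := #|_|.
rewrite (eq_bigl xpredT) => [->|d]; last by rewrite inE.
rewrite muln0 add0n hS => E.
(* The member with parameter 0 is w itself. *)
have y20 : (0 < y2)%N.
  by apply/card_gt0P; exists 0; rewrite !inE scale0r addr0 wb eqxx.
have y10 : y1 = 0%N.
  apply: (@pencil_type_counts q y1 y2) => //; first exact: odd_or_dvd4_card_finField.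
    by lia.
  apply/eqP; rewrite -(eqn_pmul2l Q0); apply/eqP.
  by move: E; rewrite /a /b; clear; lia.
apply/eqP => ca; have : (0 < y1)%N by apply/card_gt0P; exists c; rewrite !inE ca eqxx.
by rewrite y10.
Qed.

(** * Hyperplanes through a subspace *)

(** The map (w, c) -> w + c z is injective on pairs with w in [0 |: B]: a vector v spanning a point
    of S in tau is killed by w but not by z, so evaluation at v recovers c. Its values are zero or
    of type 0 or b, so (|B| + 1) q <= q^3. The element 0 adjoined to [B] accounts for the multiples
    of z. *)
Lemma card_large_sections_through (F : finFieldType) (r : nat)
    (S : {set point F r}) (tau : projsp F r) :
    let q := #|F| in let a := (q ^ (r - 3) * (q + 2))%N in
    let b := (2 * q * q ^ (r - 3))%N in
    (4 <= q)%N -> (3 <= r)%N -> #|S| = (q * a)%N -> three_sections S a b ->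
    (0 < #|points_on tau :&: S|)%N ->
  (#|[set u in annihilator tau :\ 0%R | section_size S u == b]| + 1 <= q ^ 2)%N.
Proof.
move=> q a b q4 r3 hS h3 /card_gt0P[p]; rewrite !inE => /andP[ptau pS].
have [] := count_empty_and_large_sections q4 r3 hS h3.
rewrite -/q -/b; set Z := [set u in _ | _]; set D := [set u in _ | _].
move=> ZD /card_gt0P[z]; rewrite !inE => /andP[z0 /eqP Sz].
set B := [set u in _ | _].
have Q0 : (0 < q ^ (r - 3))%N by rewrite expn_gt0; lia.
have [v v0 pv] := point_generator p.
have vB w : w \in 0 |: B -> v *m w = 0.
  rewrite !inE => /orP[/eqP ->|/andP[/andP[_ tw] _]]; first by rewrite mulmx0.
  by apply/eqP; rewrite -mem_functional_ker memvE -pv (subv_trans ptau).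
have vz : v *m z != 0.
  apply/eqP => vz; move/eqP: Sz; rewrite cards_eq0 => /eqP/setP/(_ p).
  by rewrite !inE pS andbT pv -memvE mem_functional_ker vz eqxx.
pose f (x : 'cV[F]_r.+1 * F) := x.1 + x.2 *: z.
have f_inj : {in setX (0 |: B) [set: F] &, injective f}.
  move=> [w c] [w' c'] /setXP[wB _] /setXP[wB' _]; rewrite /f /= => ff.
  have := congr1 (mulmx v) ff; rewrite !mulmxDr -!scalemxAr (vB _ wB) (vB _ wB') !add0r.
  move/eqP; rewrite -subr_eq0 -scalerBl scaler_eq0 (negPf vz) orbF subr_eq0.
  by move/eqP=> cc; move: ff; rewrite cc => /addIr ->.
have f_im : f @: setX (0 |: B) [set: F] \subset 0 |: (Z :|: D).
  apply/subsetP => _ /imsetP[[w c] /setXP[wB _] ->]; rewrite /f /=.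
  move: wB; rewrite 2!inE => /orP[/eqP ->|]; last first.
    rewrite !inE => /andP[/andP[w0 _] /eqP wb].
    have [n0 na] := pencil_avoids_middle c q4 Q0 hS h3 Sz w0 wb.
    rewrite n0 /=; have [->|e|->] := h3 _ n0; rewrite ?eqxx ?orbT //.
    by rewrite e eqxx in na.
  rewrite add0r !inE scaler_eq0 (negPf z0) orbF.
  by have [//|c0] := eqVneq c 0; rewrite section_sizeZ // Sz eqxx.
have := subset_leq_card f_im; rewrite (card_in_imset f_inj) cardsX cardsT -/q.
rewrite cardsU1 !inE eqxx /= add1n => le.
have : (#|0%R |: (Z :|: D)| <= q ^ 3)%N.
  rewrite cardsU1 -ZD addnC leq_add ?leq_b1 //.
  by rewrite cardsU leq_subr.
by move=> /(leq_trans le); rewrite expnSr addn1 leq_pmul2r //; lia.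
Qed.

Theorem theorem5p4 (F : finFieldType) (q r : nat) (hF : #|F| = q)
    (hq : (4 <= q)%N) (hr : (4 <= r)%N) (S : {set point F r})
    (hS : #|S| = (q ^ (r - 1) + 2 * q ^ (r - 2))%N)
    (hH : forall H : projsp F r, has_pdim H (r - 1) ->
       [\/ #|points_on H :&: S| = 0%N,
           #|points_on H :&: S| = (q ^ (r - 2) + 2 * q ^ (r - 3))%N
         | #|points_on H :&: S| = (2 * q ^ (r - 2))%N])
    (i : nat) (hi : (1 <= i <= r - 2)%N)
    (tau : projsp F r) (htau : has_pdim tau (r - i)) :
  (exists c : int,
      - q%:Z <= c <= 1 /\
      #|points_on tau :&: S|%:Z
        = 2 * q%:Z ^+ (r - i - 1)
          + c * (- q%:Z ^+ (r - i - 1) + 2 * q%:Z ^+ (r - i - 2)))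
  \/ #|points_on tau :&: S| = 0%N.

Proof.
have [n0|n0] := posnP #|points_on tau :&: S|; [by right|left].
subst q; set q := #|F| in hq hS hH *; set n := #|_ :&: _| in n0 *.
case/andP: hi => i1 ir.
pose Q := (q ^ (r - 3))%N; pose a := (Q * (q + 2))%N; pose b := (2 * q * Q)%N.
have q0 : (0 < q)%N by lia.
have Q0 : (0 < Q)%N by rewrite expn_gt0 q0.
have a0 : (0 < a)%N by rewrite muln_gt0 Q0; lia.
have ab : (a < b)%N by rewrite /a /b; nia.
have Q1 : (q ^ (r - 2) = q * Q)%N by rewrite -expnS; congr (_ ^ _)%N; lia.
have Q2 : (q ^ (r - 1) = q * (q * Q))%N by rewrite -!expnS; congr (_ ^ _)%N; lia.
have sS : #|S| = (q * a)%N by rewrite hS Q1 Q2 /a; lia.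
have h3 : three_sections S a b.
  move=> u u0; have [|||] := hH (functional_ker u).
  - by rewrite /has_pdim dim_functional_ker //; lia.
  - by constructor 1.
  - by rewrite Q1 => e; constructor 2; rewrite /section_size e /a /Q; lia.
  - by rewrite Q1 => e; constructor 3; rewrite /section_size e /b; lia.
have r3 : (3 <= r)%N by lia.
have := card_large_sections_through hq r3 sS h3 n0.
rewrite -/q -/Q -/b; set X2 := #|_| => X2le.
(* Exactly q^i = P q functionals vanish on tau, and [R] is the lower power of q in the claimed
   formula. *)
pose P := (q ^ (i - 1))%N; pose R := (q ^ (r - i - 2))%N.
have PR : (Q = P * R)%N by rewrite -expnD; congr (_ ^ _)%N; lia.
have P0 : (0 < P)%N by rewrite expn_gt0 q0.
have hA : {in annihilator tau :\ 0, forall u, [\/ section_size S u = 0,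
    section_size S u = a | section_size S u = b]%N}.
  by move=> u; rewrite !inE => /andP[u0 _]; apply: h3.
(* A hyperplane through tau contains the points of S on tau, so none has type 0. *)
have X00 : #|[set u in annihilator tau :\ 0 | section_size S u == 0%N]| = 0%N.
  apply/eqP; rewrite cards_eq0; apply/eqP/setP => u; rewrite !inE.
  apply/negP => /andP[/andP[_ tu]]; apply/negP; rewrite -lt0n (leq_trans n0) //.
  apply/subset_leq_card/setSI/subsetP => p; rewrite !inE => pt.
  exact: subv_trans tu.
have ann0 : 0 \in annihilator tau by rewrite inE functional_ker0 subvf.
have sumA h : (\sum_(u in annihilator tau) h (section_size S u) = h #|S| +
    (#|[set u in annihilator tau :\ 0%R | section_size S u == a]| * h a + X2 * h b))%N.
  rewrite (bigD1 0%R) //= section_size0; congr (_ + _)%N.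
  have := sum_three_valued h a0 ab hA; rewrite X00 mul0n add0n => <-.
  by apply: eq_bigl => u; rewrite !inE andbC.
move: sumA; set X1 := #|[set u in _ | _ == a]| => sumA.
have EX : (X1 + X2 + 1 = P * q)%N.
  have := sumA (fun=> 1%N).
  rewrite sum1_card card_annihilator htau !muln1 addnC => <-.
  by rewrite -expnSr; congr (_ ^ _)%N; lia.
have ES : (a * X1 + b * X2 + q * a = n * (P * q) + (q * a - n) * P)%N.
  have := sumA id; rewrite (@sum_section_size_annihilator _ _ (i - 1)); last first.
    by rewrite htau; lia.
  rewrite -/q -/n sS expnSr -/P => ->.
  by rewrite addnC ![(_ * X1)%N]mulnC ![(_ * X2)%N]mulnC.
have ns : (n <= q * a)%N by rewrite -sS subset_leq_card ?subsetIr.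
move: ns ES; rewrite /a /b PR => ns ES.
have [h Xh nh] := subspace_section_size hq P0 ns EX ES.
(* From (q - 1) h + 1 <= q^2. *)
have hle : (h <= q + 1)%N.
  move: X2le; rewrite Xh; move: hq; rewrite -/q; clear.
  case: (q) => // k k3; rewrite subn1 /= => X2le; rewrite leqNgt; apply/negP => lt.
  by have := leq_mul (leqnn k) lt; lia.
(* R (q + 2) + R (q - 2) h = 2 q R + (1 - h)(-q R + 2 R), and 0 <= h <= q + 1 gives the range of
   c. *)
exists (1 - h%:Z); split; first by lia.
have -> : (r - i - 1 = (r - i - 2).+1)%N by lia.
have [m qm] : exists m, q = (m + 2)%N.
  by exists (q - 2)%N; rewrite subnK // (leq_trans _ hq).
have RE : q%:Z ^+ (r - i - 2) = R%:Z by rewrite -!natz natrX.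
move: nh; rewrite exprS RE -/R.
by rewrite qm addnK => ->; rewrite !PoszD !PoszM !PoszD; ring.
Qed.
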